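(* Let $s$ be a state-morphism on an $EMV$-algebra $M$. Then $\mathrm{Ker}(s)=\{x\in M\mid s(x)=0\}$ is a maximal ideal of $M$ and $\mathrm{Ker}_1(s)=\{x\in M\mid s(x)=1\}$ is a maximal filter of $M$. Conversely, for each maximal ideal $I$ of $M$ and each maximal filter $F$ of $M$, there are unique state-morphisms $s$ and $s_1$ on $M$ such that $I=\mathrm{Ker}(s)$ and $F=\mathrm{Ker}_1(s_1)$.
   Context: An $EMV$-algebra is an algebra $(M;\vee,\wedge,\oplus,0)$ of type $(2,2,2,0)$ such that: (i) $(M;\oplus,0)$ is a commutative monoid with neutral element $0$; (ii) $(M;\vee,\wedge,0)$ is a distributive lattice with bottom element $0$; (iii) for each idempotent $a$ of $M$ (an element with $a\oplus a=a$; $\mathcal I(M)$ denotes the set of idempotents), $([0,a];\oplus,\lambda_a,0,a)$ is an $MV$-algebra, where $[0,a]=\{x\in M\mid x\le a\}$ and $\lambda_a(x)=\min\{z\in[0,a]\mid z\oplus x=a\}$; (iv) for each $x\in M$ there is $a\in\mathcal I(M)$ with $x\le a$. A top element is not assumed. For $x,y\in M$ one sets $x\odot y:=\lambda_a(\lambda_a(x)\oplus\lambda_a(y))$ for any $a\in\mathcal I(M)$ with $x,y\le a$; this does not depend on $a$. An $EMV$-homomorphism is a map $f$ between $EMV$-algebras preserving $\vee,\wedge,\oplus,0$ with $f(\lambda_b(x))=\lambda_{f(b)}(f(x))$ for each idempotent $b$ and $x\in[0,b]$. A state-morphism on $M$ is an $EMV$-homomorphism $s:M\to[0,1]$ (with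 $[0,1]$ the standard $MV$-algebra, $x\oplus y=\min\{x+y,1\}$) such that $s(x)=1$ for some $x\in M$. An ideal of $M$ is a non-empty subset that is downward closed and closed under $\oplus$. A filter of $M$ is a non-empty subset that is upward closed and closed under $\odot$. An ideal (filter) is maximal if it is proper and not properly contained in another proper ideal (filter).
   Formalization: The commutative monoid (M;⊕,0) is taken to be ordered (x ≤ y implies x⊕z ≤ y⊕z); without this the claim fails, e.g. for continuous functions [0,1]→[0,1] with truncated sum and a linear order refining comparison of integrals. *)

(* Defs.v *)
From HB Require Import structures.
From mathcomp Require Import all_boot all_order all_algebra.
From mathcomp Require Import interval_inference.
From mathcomp Require Import boolp classical_sets reals.
From mathcomp Require Import lra.

Set Implicit Arguments.
Unset Strict Implicit.
Unset Printing Implicit Defensive.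

Import Order.TTheory GRing.Theory Num.Theory.

Local Open Scope classical_set_scope.
Local Open Scope order_scope.

(* The subset A of T, with the operations restricted to it, is an MV-algebra. *)
Record MV_algebra_on (T : Type) (A : set T) (op : T -> T -> T)
    (neg : T -> T) (zero one : T) : Prop := {
  mv_op_closed : forall x y, A x -> A y -> A (op x y);
  mv_neg_closed : forall x, A x -> A (neg x);
  mv_zero_closed : A zero;
  mv_one_closed : A one;
  mv_opA : forall x y z, A x -> A y -> A z -> op x (op y z) = op (op x y) z;
  mv_opC : forall x y, A x -> A y -> op x y = op y x;
  mv_op0 : forall x, A x -> op x zero = x;
  mv_negK : forall x, A x -> neg (neg x) = x;
  mv_neg0 : neg zero = one;
  mv_op1 : forall x, A x -> op x one = one;
  mv_luk : forall x y, A x -> A y ->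
    op (neg (op (neg x) y)) y = op (neg (op (neg y) x)) x
}.

Definition is_min d (T : porderType d) (A : set T) (x : T) : Prop :=
  A x /\ lbound A x.

(* The candidates for lambda_a(x), and their minimum; the value \bot is a
   dummy used only when there is no minimum. *)
Definition lam_set d (T : porderType d) (op : T -> T -> T) (a x : T) : set T :=
  [set z | z <= a /\ op z x = a].

Definition lam d (T : bPOrderType d) (op : T -> T -> T) (a x : T) : T :=
  xget \bot [set z | is_min (lam_set op a x) z].

Lemma lam_eq d (T : bPOrderType d) (op : T -> T -> T) (a x z : T) :
  is_min (lam_set op a x) z -> lam op a x = z.
Proof.
move=> [Sz lz]; apply: xget_unique => // y [Sy ly].
by apply/eqP; rewrite eq_le ly ?lz.
Qed.

(* The zero of M is the bottom \bot of the lattice. The monoid (M; oplus, 0) is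
   an ordered one, which is equivalent to requiring that, on each [0, a], the
   lattice order is the natural order of the MV-algebra. The other axioms do not
   imply it: on the continuous functions from [0, 1] to [0, 1] with truncated
   addition, replace the pointwise order by a linear extension refining the
   comparison of integrals; then {0} is a maximal ideal, but no state-morphism
   exists. *)
HB.mixin Record isEMV d M of Order.BDistrLattice d M := {
  oplus : M -> M -> M;
  oplusA : associative oplus;
  oplusC : commutative oplus;
  oplus0 : right_id \bot oplus;
  le_oplus2r : forall x y z : M, x <= y -> oplus x z <= oplus y z;
  lam_exists : forall a x : M, oplus a a = a -> x <= a ->
    exists z, is_min (lam_set oplus a x) z;
  interval_MV : forall a : M, oplus a a = a ->
    MV_algebra_on [set x | x <= a] oplus (lam oplus a) \bot a;
  idem_cofinal : forall x : M, exists2 a, oplus a a = a & x <= a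
}.

#[short(type="emvType")]
HB.structure Definition EMV d := {M of isEMV d M & Order.BDistrLattice d M}.

Section EMVTheory.
Context {d : Order.disp_t} {M : emvType d}.
Implicit Types (a x y : M) (I F : set M).

Definition idem : set M := [set a | oplus a a = a].

Definition lambda a x : M := lam oplus a x.

Definition odot_in a x y : M := lambda a (oplus (lambda a x) (lambda a y)).

(* An idempotent above x and y is chosen; the result does not depend on it,
   see [odotE]. *)
Definition odot x y : M :=
  odot_in (xget \bot [set a | idem a /\ (x <= a /\ y <= a)]) x y.

Lemma lambdaP a x : idem a -> x <= a ->
  [/\ lambda a x <= a, oplus (lambda a x) x = a &
      forall z, z <= a -> oplus z x = a -> lambda a x <= z].
Proof.
move=> ia xa; have [z mz] := lam_exists a x ia xa.
rewrite /lambda (lam_eq mz); case: mz => -[za zx] lz.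
by split => // w wa wx; apply: lz.
Qed.

Let odot_in_le a b x y : idem a -> idem b -> a <= b -> x <= a -> y <= a ->
  odot_in a x y = odot_in b x y.
Proof.
move=> ia ib ab xa ya; have mv := interval_MV _ ib.
pose N := lambda b; pose u := N a.
have mono z p q : p <= q -> oplus z p <= oplus z q.
  by rewrite !(oplusC z); exact: le_oplus2r.
have le_trb p : p <= a -> p <= b by move=> /le_trans; apply.
have cN p : p <= b -> N p <= b by case/(lambdaP ib).
have cD p q : p <= b -> q <= b -> oplus p q <= b by exact: (mv_op_closed mv).
have NK p : p <= b -> N (N p) = p by exact: (mv_negK mv).
have ub : u <= b by exact: cN.
have Nb : N b = \bot.
  by rewrite -[RHS]NK ?le0x // /N /lambda (mv_neg0 mv).
have lamK p : p <= b -> oplus (N p) p = b by case/(lambdaP ib).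
have NaD p : p <= a -> oplus (N p) a = b.
  move=> pa; apply/le_anti/andP; split; first by rewrite cD ?cN ?le_trb.
  by rewrite -[X in X <= _](lamK p) ?le_trb //; exact: mono.
have luk p q : p <= b -> q <= b ->
    oplus (N (oplus (N p) q)) q = oplus (N (oplus (N q) p)) p.
  exact: (mv_luk mv).
have uu : oplus u u = u.
  have uub : oplus u u <= b by exact: cD.
  have h : oplus (N (oplus u u)) u = b.
    have := luk a u ab ub; rewrite -/u (NK a) // ia => ->.
    by rewrite lamK.
  have aN : a <= N (oplus u u).
    have [_ _ /(_ (N (oplus u u)))] := lambdaP ib ub.
    by rewrite -/(N u) NK //; apply => //; exact: cN.
  apply/le_anti/andP; split; last first.
    by rewrite -[X in X <= _](oplus0 u); apply: mono; exact: le0x.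
  rewrite -[X in X <= _]NK //.
  have [_ _] := lambdaP ib (cN _ uub); apply => //.
  apply/le_anti/andP; split; first by rewrite cD ?cN.
  by rewrite -[X in X <= _](lamK a) //; exact: mono.
have lamaE p : p <= a -> lambda a p = N (oplus u p).
  move=> pa; have pb := le_trb _ pa.
  have hp : oplus (N (oplus u p)) p = a.
    by have := luk a p ab pb; rewrite (NaD p) // Nb [RHS]oplusC oplus0.
  have lep : N (oplus u p) <= a.
    by rewrite -[X in _ <= X]hp -[X in X <= _]oplus0; apply: mono; exact: le0x.
  have [nza nzp nzl] := lambdaP ia pa.
  apply/le_anti/andP; split; first exact: nzl.
  have [_ _] := lambdaP ib (cD _ _ ub pb); apply; first exact: le_trb.
  by rewrite (oplusC u) oplusA nzp oplusC lamK.
have NE p : p <= a -> oplus (N (oplus u p)) u = N p.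
  move=> pa; have pb := le_trb _ pa.
  have := luk (N p) u (cN _ pb) ub; rewrite NK // (NK a) // [oplus p u]oplusC => ->.
  by rewrite [oplus a _]oplusC (NaD p) // Nb oplusC oplus0.
rewrite /odot_in lamaE; last first.
  by apply: (mv_op_closed (interval_MV _ ia)); apply: (mv_neg_closed (interval_MV _ ia)).
rewrite !lamaE // -/N -(NE x) // -(NE y) //; congr N.
set p := N _; set q := N _.
by rewrite -[RHS]oplusA [oplus q u]oplusC [oplus u (oplus u q)]oplusA uu
  [LHS]oplusA [oplus u p]oplusC -oplusA.
Qed.

Lemma odotE a x y : idem a -> x <= a -> y <= a -> odot x y = odot_in a x y.
Proof.
move=> ia xa ya; rewrite /odot.
have [ib [xb yb]] : [set a | idem a /\ (x <= a /\ y <= a)]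
    (xget \bot [set a | idem a /\ (x <= a /\ y <= a)]).
  by apply: xgetPex; exists a.
set b := xget _ _ in ib xb yb *.
have [c ic] := idem_cofinal (a `|` b); rewrite leUx => /andP[ac bc].
by rewrite (odot_in_le ia ic) // (odot_in_le ib ic).
Qed.

Definition emv_ideal I : Prop :=
  [/\ I !=set0,
      forall x y, x <= y -> I y -> I x &
      forall x y, I x -> I y -> I (oplus x y)].

Definition emv_filter F : Prop :=
  [/\ F !=set0,
      forall x y, x <= y -> F x -> F y &
      forall x y, F x -> F y -> F (odot x y)].

Definition maximal_ideal I : Prop :=
  [/\ emv_ideal I, I <> setT &
      forall J : set M, emv_ideal J -> J <> setT -> ~ (I `<` J)].

Definition maximal_filter F : Prop :=
  [/\ emv_filter F, F <> setT &
      forall G : set M, emv_filter G -> G <> setT -> ~ (F `<` G)].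

End EMVTheory.

Arguments idem {d} M.

Record EMV_homomorphism d d' (M : emvType d) (N : emvType d') (f : M -> N) :
    Prop := {
  hom_join : {morph f : x y / x `|` y};
  hom_meet : {morph f : x y / x `&` y};
  hom_oplus : {morph f : x y / oplus x y};
  hom_zero : f \bot = \bot;
  hom_lambda : forall b x : M, idem M b -> x <= b ->
    f (lambda b x) = lambda (f b) (f x)
}.

(* The standard MV-algebra [0, 1]. *)
Definition unit_itv (R : realType) : Type := {i01 R}.

Section UnitInterval.
Context {R : realType}.
Local Open Scope ring_scope.
Implicit Types x y z a : unit_itv R.

HB.instance Definition _ := Order.Total.on (unit_itv R).

Definition unit_val x : R := (x : {i01 R})%:num.

Definition unit0 : unit_itv R := 0%:i01.
Definition unit1 : unit_itv R := 1%:i01.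

Definition unit_oplus x y : unit_itv R :=
  (Order.min ((x : {i01 R})%:num + (y : {i01 R})%:num) 1)%:i01.

Definition unit_neg x : unit_itv R := (1 - (x : {i01 R})%:num)%:i01.

Lemma unit_val_inj : injective unit_val.
Proof. by move=> x y; exact: val_inj. Qed.

Lemma unit_val_ge0 x : 0 <= unit_val x. Proof. by rewrite /unit_val. Qed.

Lemma unit_val_le1 x : unit_val x <= 1. Proof. by rewrite /unit_val. Qed.

Lemma unit_leE x y : (x <= y) = (unit_val x <= unit_val y). Proof. by []. Qed.

Lemma unit_oplusE x y :
  unit_val (unit_oplus x y) = Order.min (unit_val x + unit_val y) 1.
Proof. by []. Qed.

Lemma unit_negE x : unit_val (unit_neg x) = 1 - unit_val x. Proof. by []. Qed.

Lemma unit_ge0 x : unit0 <= x. Proof. exact: unit_val_ge0. Qed.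

HB.instance Definition _ := Order.hasBottom.Build _ (unit_itv R) unit_ge0.

Lemma unit_botE : unit_val \bot = 0. Proof. by []. Qed.

Lemma unit_oneE : unit_val unit1 = 1. Proof. by []. Qed.

Local Ltac unit_lra :=
  rewrite ?unit_leE ?unit_oplusE ?unit_negE ?unit_botE ?unit_oneE /Order.min;
  repeat match goal with
  | |- context [unit_val ?x] =>
      move: (unit_val_ge0 x) (unit_val_le1 x); generalize (unit_val x) => ?
  end; repeat case: ifP; lra.

Lemma unit_oplusA : associative unit_oplus.
Proof. move=> x y z; apply: unit_val_inj; unit_lra. Qed.

Lemma unit_oplusC : commutative unit_oplus.
Proof. move=> x y; apply: unit_val_inj; unit_lra. Qed.

Lemma unit_oplus0 : right_id \bot unit_oplus.
Proof. move=> x; apply: unit_val_inj; unit_lra. Qed.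

Lemma unit_le_oplus2r x y z : x <= y -> unit_oplus x z <= unit_oplus y z.
Proof. unit_lra. Qed.

Lemma unit_idem a : unit_oplus a a = a -> a = \bot \/ a = unit1.
Proof.
move=> /(congr1 unit_val); rewrite unit_oplusE /Order.min.
case: ifP => _ ha; [left | right]; apply: unit_val_inj.
- by rewrite unit_botE; lra.
- by rewrite -ha.
Qed.

Lemma unit_lam_min a x : unit_oplus a a = a -> x <= a ->
  exists2 z, unit_val z = unit_val a - unit_val x &
             is_min (lam_set unit_oplus a x) z.
Proof.
move=> /unit_idem[] -> xa.
- exists \bot.
    by move: xa; unit_lra.
  split; last by move=> y _; exact: unit_ge0.
  by split => //; apply: unit_val_inj; move: xa; unit_lra.
- exists (unit_neg x) => //.
  split; last by move=> y [_ /(congr1 unit_val)]; unit_lra.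
  by split; [|apply: unit_val_inj]; move: xa; unit_lra.
Qed.

Lemma unit_lamE a x : unit_oplus a a = a -> x <= a ->
  unit_val (lam unit_oplus a x) = unit_val a - unit_val x.
Proof. by move=> ia xa; have [z <- /lam_eq ->] := unit_lam_min ia xa. Qed.

Lemma unit_lam_exists a x : unit_oplus a a = a -> x <= a ->
  exists z, is_min (lam_set unit_oplus a x) z.
Proof. by move=> ia xa; have [z _] := unit_lam_min ia xa; exists z. Qed.

Lemma unit_interval_MV a : unit_oplus a a = a ->
  MV_algebra_on [set x | x <= a]%classic unit_oplus (lam unit_oplus a) \bot a.
Proof.
move=> ia.
have cD x y : x <= a -> y <= a -> unit_oplus x y <= a.
  by case: (unit_idem ia) => ->; rewrite ?unit_leE; unit_lra.
have cN x : x <= a -> lam unit_oplus a x <= a.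
  by move=> xa; rewrite unit_leE unit_lamE //; unit_lra.
have b0 : \bot <= a by exact: unit_ge0.
have va : unit_val a = 0 \/ unit_val a = 1.
  by case: (unit_idem ia) => ->; [left | right].
split => /=.
- exact: cD.
- exact: cN.
- exact: b0.
- exact: lexx.
- by move=> *; exact: unit_oplusA.
- by move=> *; exact: unit_oplusC.
- by move=> *; exact: unit_oplus0.
- move=> x xa; apply: unit_val_inj; rewrite !unit_lamE ?cN //; lra.
- by apply: unit_val_inj; rewrite unit_lamE // unit_botE subr0.
- move=> x xa; apply: unit_val_inj; move: va xa.
  by move=> [] e; rewrite unit_leE unit_oplusE e; unit_lra.
- move=> x y xa ya; apply: unit_val_inj.
  rewrite !(unit_oplusE, unit_lamE) ?(cD, cN) //.
  move: va xa ya; rewrite !unit_leE => -[] ->; unit_lra.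
Qed.

Lemma unit_idem_cofinal x : exists2 a, unit_oplus a a = a & x <= a.
Proof.
exists unit1; last exact: unit_val_le1.
by apply: unit_val_inj; unit_lra.
Qed.

HB.instance Definition _ := isEMV.Build _ (unit_itv R)
  unit_oplusA unit_oplusC unit_oplus0 unit_le_oplus2r
  unit_lam_exists unit_interval_MV unit_idem_cofinal.

End UnitInterval.

Record state_morphism (R : realType) d (M : emvType d) (s : M -> unit_itv R) :
    Prop := {
  state_hom : EMV_homomorphism s;
  state_one : exists x, unit_val (s x) = 1%R
}.

Definition Ker (R : realType) d (M : emvType d) (s : M -> unit_itv R) : set M :=
  [set x | unit_val (s x) = 0%R].

Definition Ker1 (R : realType) d (M : emvType d) (s : M -> unit_itv R) : set M :=
  [set x | unit_val (s x) = 1%R].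

(* Main.v *)
From HB Require Import structures.
Require Import Defs.
From mathcomp Require Import all_boot all_order all_algebra.
From mathcomp Require Import interval_inference.
From mathcomp Require Import boolp classical_sets reals.
From mathcomp Require Import generic_quotient lra zify.

(** Addition on an EMV-algebra has a residual: x ⊖ y is the least u with
    x <= y ⊕ u. In an interval [0, a] with a idempotent, ⊖ is the truncated
    difference of the MV-algebra [0, a], so lambda_a x = a ⊖ x and
    x ⊙ y = x ⊖ (a ⊖ y). As ⊖ refers to no idempotent, most of the argument can
    be carried out in M itself, without choosing intervals.

    A state-morphism s sends x ⊖ y to the positive part of s(x) - s(y), and the
    n-fold sum n x = x ⊕ ... ⊕ x to min (n s(x), 1). Hence an ideal that properly
    contains Ker s contains an element n x of value 1, and then every y, because
    y <= n x ⊕ (y ⊖ n x) and s (y ⊖ n x) = 0. Dually, a filter that properly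
    contains Ker_1 s contains the complement of an element of value 1, and thus
    the bottom. A state-morphism is determined by Ker_1 s: the first binary digit
    of s(x) tells whether s (x ⊕ x) = 1, and the others are the digits of the value
    of x ⊙ x or x ⊕ x ([Ker1_inj]).

    Conversely, let I be a maximal ideal. From (x ⊖ y) ∧ (y ⊖ x) = 0 and the
    maximality of I, one of x ⊖ y and y ⊖ x is in I, and for an idempotent a
    outside I every x ⊖ a is in I. So M / I is a simple totally ordered
    MV-algebra with top a / I, and it remains to embed such a chain T in [0, 1]
    ([simple_chain_embedding]). For this, nat * T is made into a commutative
    semigroup by addition with carry, (n, x) standing for n + x; the integer part
    of 2^j (0, x), divided by 2^j, converges to a real number, additively in x.

    For a maximal filter F, the elements below some lambda_a f with f in F form a
    maximal ideal ([dual_ideal_maximal]). Its state-morphism s has value 1 on F,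
    so F is contained in the proper filter Ker_1 s, and is equal to it. *)

Set Implicit Arguments.
Unset Strict Implicit.
Unset Printing Implicit Defensive.

Import Order.TTheory GRing.Theory Num.Theory.

Local Open Scope classical_set_scope.
Local Open Scope order_scope.

Local Notation "x ⊕ y" := (oplus x y) (at level 50, left associativity).

(** * Residuation *)

Section Arithmetic.
Context {d : Order.disp_t} {M : emvType d}.
Implicit Types (a b t u x y z w : M).

Lemma le_oplusl x y z : y <= z -> x ⊕ y <= x ⊕ z.
Proof. by rewrite ![x ⊕ _]oplusC; exact: le_oplus2r. Qed.

Lemma le_oplus x x' y y' : x <= x' -> y <= y' -> x ⊕ y <= x' ⊕ y'.
Proof.
by move=> xx yy; exact: le_trans (le_oplus2r _ _ _ xx) (le_oplusl _ yy).
Qed.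

Lemma le_oplus_addr x y : x <= x ⊕ y.
Proof. by rewrite -[leLHS]oplus0; apply: le_oplusl; exact: le0x. Qed.

Lemma le_oplus_addl x y : x <= y ⊕ x.
Proof. by rewrite oplusC; exact: le_oplus_addr. Qed.

Lemma oplus_idem_le a x y : idem M a -> x <= a -> y <= a -> x ⊕ y <= a.
Proof. by move=> ia xa ya; rewrite -[leRHS]ia; exact: le_oplus. Qed.

Lemma idem_above2 x y : exists2 a, idem M a & x <= a /\ y <= a.
Proof.
by have [a ia] := idem_cofinal (x `|` y); rewrite leUx => /andP[]; exists a.
Qed.

Lemma idem_above3 x y z : exists2 a, idem M a & [/\ x <= a, y <= a & z <= a].
Proof.
have [a ia] := idem_cofinal (x `|` y `|` z).
by rewrite !leUx => /andP[/andP[]]; exists a.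
Qed.

Lemma lambda_le_idem b x : idem M b -> x <= b -> lambda b x <= b.
Proof. by move=> ib /(lambdaP ib)[]. Qed.

Lemma lambdaK b x : idem M b -> x <= b -> lambda b (lambda b x) = x.
Proof. by move=> ib; exact: (mv_negK (interval_MV _ ib)). Qed.

Lemma lambda_le b x u : idem M b -> x <= b -> u <= b ->
  (lambda b x <= u) = (b <= x ⊕ u).
Proof.
move=> ib xb ub; have [lb lx lmin] := lambdaP ib xb; apply/idP/idP => h.
  by rewrite -[leLHS]lx oplusC; exact: le_oplusl.
apply: lmin => //; apply/le_anti.
by rewrite oplus_idem_le //= oplusC.
Qed.

(** The Galois connection inside [0, b]: up to lambda_b both sides say that the
    sum of lambda_b t, x and u is b. *)
Let adj_in b t x u : idem M b -> t <= b -> x <= b -> u <= b ->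
  (lambda b (lambda b t ⊕ x) <= u) = (t <= x ⊕ u).
Proof.
move=> ib tb xb ub; have lt := lambda_le_idem ib tb.
rewrite lambda_le ?oplus_idem_le // -oplusA.
by rewrite -lambda_le ?oplus_idem_le // lambdaK.
Qed.

(** ⊕ preserves meets because it is a right adjoint. *)
Lemma oplusIr x y z : x ⊕ (y `&` z) = (x ⊕ y) `&` (x ⊕ z).
Proof.
have [b ib [xb yb zb]] := idem_above3 x y z.
apply/le_anti; rewrite lexI !le_oplusl ?leIl ?leIr //=.
have tb : (x ⊕ y) `&` (x ⊕ z) <= b.
  by apply: le_trans (leIl _ _) _; exact: oplus_idem_le.
have yzb : y `&` z <= b by exact: le_trans (leIl _ _) yb.
by rewrite -(adj_in ib) // lexI !(adj_in ib) // leIl leIr.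
Qed.

Lemma oplusIl x y z : (y `&` z) ⊕ x = (y ⊕ x) `&` (z ⊕ x).
Proof. by rewrite oplusC oplusIr ![x ⊕ _]oplusC. Qed.

Lemma meet_oplus_le x y z : x `&` (y ⊕ z) <= (x `&` y) ⊕ (x `&` z).
Proof.
rewrite oplusIr !oplusIl !lexI leIr andbT.
have xl t : x `&` (y ⊕ z) <= x ⊕ t.
  exact: le_trans (leIl _ _) (le_oplus_addr _ _).
by rewrite !xl [y ⊕ x]oplusC xl.
Qed.

(** The difference computed in [0, b] has the universal property against every u
    of M: u may be replaced by b ∧ u, since t <= b and ⊕ distributes over ∧. *)
Lemma residual_exists t x : exists z, forall u, (z <= u) = (t <= x ⊕ u).
Proof.
have [b ib [tb xb]] := idem_above2 t x.
exists (lambda b (lambda b t ⊕ x)) => u.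
have zb : lambda b (lambda b t ⊕ x) <= b.
  by rewrite lambda_le_idem ?oplus_idem_le ?lambda_le_idem.
transitivity (lambda b (lambda b t ⊕ x) <= b `&` u); first by rewrite lexI zb.
rewrite (adj_in ib) ?leIl //; apply/idP/idP => h.
  by apply: le_trans h _; rewrite le_oplusl ?leIr.
rewrite oplusIr lexI h andbT.
by apply: le_trans tb _; exact: le_oplus_addl.
Qed.

Definition residual t x : M :=
  xget \bot [set z | forall u, (z <= u) = (t <= x ⊕ u)].

Local Notation "x ⊖ y" := (residual x y) (at level 50, left associativity).

Lemma residual_le t x u : (t ⊖ x <= u) = (t <= x ⊕ u).
Proof.
rewrite /residual.
by have := xgetPex \bot (residual_exists t x); exact.
Qed.

Lemma residualE b t x : idem M b -> t <= b -> x <= b ->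
  t ⊖ x = lambda b (lambda b t ⊕ x).
Proof.
move=> ib tb xb.
have zb : lambda b (lambda b t ⊕ x) <= b.
  by rewrite lambda_le_idem ?oplus_idem_le ?lambda_le_idem.
have mb : t ⊖ x <= b by rewrite residual_le (le_trans tb) ?le_oplus_addl.
apply/le_anti; rewrite residual_le -(adj_in ib) // lexx /=.
by rewrite (adj_in ib) // -residual_le.
Qed.

Lemma lambda_residual b x : idem M b -> x <= b -> lambda b x = b ⊖ x.
Proof.
move=> ib xb; rewrite (residualE ib) //.
have := lambdaK ib (le0x b).
rewrite {2}/lambda (mv_neg0 (interval_MV _ ib)) => ->.
by rewrite oplusC oplus0.
Qed.

Lemma le_residual t x : t <= x ⊕ (t ⊖ x).
Proof. by rewrite -residual_le. Qed.

Lemma residual_le_self t x : t ⊖ x <= t.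
Proof. by rewrite residual_le le_oplus_addl. Qed.

Lemma residual_mono t t' x x' : t <= t' -> x' <= x -> t ⊖ x <= t' ⊖ x'.
Proof.
move=> tt xx; rewrite residual_le (le_trans tt) //.
rewrite (le_trans (le_residual t' x')) //.
exact: le_oplus2r.
Qed.

Lemma residual_eq0 x y : x <= y -> x ⊖ y = \bot.
Proof. by move=> xy; apply/eqP; rewrite -lex0 residual_le oplus0. Qed.

(** This is where the Lukasiewicz axiom of the intervals enters; residuation
    alone gives only y <= x ⊕ (y ⊖ x). *)
Lemma oplus_residual x y : x <= y -> x ⊕ (y ⊖ x) = y.
Proof.
move=> xy; have [b ib [xb yb]] := idem_above2 x y.
have mv := interval_MV _ ib.
rewrite (residualE ib) // oplusC /lambda.
rewrite (mv_luk mv) // -/(lambda b x) -/(lambda b _).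
have -> : lambda b x ⊕ y = b.
  apply/le_anti; rewrite oplus_idem_le ?lambda_le_idem //=.
  by rewrite -lambda_le ?lambda_le_idem // lambdaK.
by rewrite lambda_residual // residual_eq0 // oplusC oplus0.
Qed.

(** The only cancellation available in M: w <= t ⊖ m makes the sum m ⊕ w free of
    truncation, so m ⊕ w = m forces w to vanish. *)
Lemma residual_cancel t m w : w <= t ⊖ m -> m ⊕ w <= m -> w = \bot.
Proof.
move=> wt mw; have [b ib [tb mb]] := idem_above2 t m.
have wm : w <= lambda b m.
  by rewrite lambda_residual // (le_trans wt) // residual_mono.
have lb := lambda_le_idem ib mb.
have wb := le_trans wm lb.
have e : m ⊕ w = m by apply/le_anti; rewrite mw le_oplus_addr.
have := mv_luk (interval_MV _ ib) (lambda_le_idem ib wb) mb.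
rewrite -!/(lambda b _) lambdaK // [w ⊕ m]oplusC e.
have -> : lambda b m ⊕ m = b by have [] := lambdaP ib mb.
have -> : lambda b (lambda b m ⊕ lambda b w) = \bot.
  rewrite lambda_residual ?oplus_idem_le ?lambda_le_idem //.
  apply: residual_eq0.
  by rewrite oplusC -lambda_le ?lambda_le_idem // lambdaK.
rewrite [X in _ = X]oplusC oplus0 => be.
by rewrite -[w](lambdaK ib) // -be lambda_residual // residual_eq0.
Qed.

(** Prelinearity. The meet m of x and y satisfies x = m ⊕ p and y = m ⊕ q with
    p = x ⊖ m and q = y ⊖ m, so m ⊕ (p ∧ q) = x ∧ y = m. As x ⊖ y <= p and
    y ⊖ x <= q, cancellation applies. *)
Lemma residual_disjoint x y : (x ⊖ y) `&` (y ⊖ x) = \bot.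
Proof.
set m := x `&` y.
have h s : m <= s -> (m ⊕ (s ⊖ m)) = s by exact: oplus_residual.
have xm : x ⊖ y <= x ⊖ m by rewrite residual_mono ?leIr.
have ym : y ⊖ x <= y ⊖ m by rewrite residual_mono ?leIl.
apply: (@residual_cancel x m); first by rewrite (le_trans (leIl _ _)).
apply: (@le_trans _ _ (m ⊕ ((x ⊖ m) `&` (y ⊖ m)))).
  by rewrite le_oplusl // leI2.
by rewrite oplusIr !h ?leIl ?leIr.
Qed.

Lemma residual_idem_disjoint t a : idem M a -> a `&` (t ⊖ a) = \bot.
Proof.
move=> ia; apply: (@residual_cancel t a); first exact: leIr.
by rewrite oplus_idem_le ?leIl.
Qed.

Lemma le_meet_residual x y : x <= (x `&` y) ⊕ (x ⊖ y).
Proof. by rewrite oplusIl lexI le_oplus_addr le_residual. Qed.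

Lemma oplusACA : interchange (@oplus d M) (@oplus d M).
Proof. by move=> x y z t; rewrite -!oplusA (oplusA y) (oplusC y) -!oplusA. Qed.

Lemma residual_triangle x y z : x ⊖ z <= (x ⊖ y) ⊕ (y ⊖ z).
Proof.
rewrite residual_le [_ ⊕ (y ⊖ z)]oplusC oplusA.
by rewrite (le_trans (le_residual x y)) // le_oplus2r ?le_residual.
Qed.

Lemma oplus_residual_le x y x' y' : (x ⊕ y) ⊖ (x' ⊕ y') <= (x ⊖ x') ⊕ (y ⊖ y').
Proof. by rewrite residual_le oplusACA le_oplus ?le_residual. Qed.

Lemma residual_residual_le x y x' y' :
  (x ⊖ y) ⊖ (x' ⊖ y') <= (x ⊖ x') ⊕ (y' ⊖ y).
Proof.
rewrite residual_le residual_le.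
apply: le_trans (le_residual x x') _.
apply: (@le_trans _ _ (y' ⊕ (x' ⊖ y') ⊕ (x ⊖ x'))).
  by rewrite le_oplus2r ?le_residual.
rewrite [y ⊕ (_ ⊕ (_ ⊕ _))](_ : _ = y ⊕ (y' ⊖ y) ⊕ ((x' ⊖ y') ⊕ (x ⊖ x'))).
  by rewrite -oplusA le_oplus2r ?le_residual.
by rewrite -!oplusA; congr (_ ⊕ _); rewrite [RHS]oplusC -!oplusA.
Qed.

Lemma odot_residual b x y : idem M b -> x <= b -> y <= b ->
  odot x y = x ⊖ (b ⊖ y).
Proof.
move=> ib xb yb; rewrite (odotE ib) // -(lambda_residual ib yb).
rewrite (residualE ib) //.
exact: lambda_le_idem.
Qed.

Lemma residualK b x : idem M b -> x <= b -> b ⊖ (b ⊖ x) = x.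
Proof.
move=> ib xb; rewrite -(lambda_residual ib xb) -lambda_residual ?lambdaK //.
exact: lambda_le_idem.
Qed.

(** In the notation of real numbers, x + y - 1 - (j + k) is
    (x - j) + (y - k) - 1. It makes the sets of all elements above some f ⊖ j,
    with f in a filter and j in an ideal, closed under ⊙. *)
Lemma odot_residual_le x y u v j k : x ⊖ j <= u -> y ⊖ k <= v ->
  odot x y ⊖ (j ⊕ k) <= odot u v.
Proof.
rewrite !residual_le => xu yv.
have [b ib [xb yb]] := idem_above2 x y.
have [c ic [bc uc vc]] := idem_above3 b u v.
have xc := le_trans xb bc; have yc := le_trans yb bc.
rewrite !(odot_residual ic) // !residual_le.
have Nv : c ⊖ v <= (c ⊖ y) ⊕ k.
  rewrite residual_le (le_trans (le_residual c y)) // [_ ⊕ k]oplusC oplusA.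
  by rewrite le_oplus2r // [v ⊕ k]oplusC.
have -> r : (c ⊖ y) ⊕ (j ⊕ k ⊕ r) = j ⊕ ((c ⊖ y) ⊕ k ⊕ r).
  by rewrite -!oplusA oplusA (oplusC _ j) -!oplusA.
apply: le_trans xu _; apply: le_oplusl.
by apply: le_trans (le_residual u (c ⊖ v)) _; exact: le_oplus2r.
Qed.

Lemma iter_oplusD x n m :
  iter (n + m) (oplus x) \bot = iter n (oplus x) \bot ⊕ iter m (oplus x) \bot.
Proof.
elim: n => [|n ih]; first by rewrite oplusC oplus0.
by rewrite addSn !iterS ih oplusA.
Qed.

End Arithmetic.

Local Notation "x ⊖ y" := (residual x y) (at level 50, left associativity).

(** * Embedding of a simple chain *)

Lemma le_dyadic (R : realType) (c x y : R) :
  (forall j, x <= y + c / 2 ^+ j)%R -> (x <= y)%R.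
Proof.
move=> h; rewrite leNgt; apply/negP => yx.
have xy0 : (0 < x - y)%R by rewrite subr_gt0.
have := @upper_nthrootP _ (c / (x - y))%R _ (leqnn _).
set j := Num.bound _; rewrite ltr_pdivrMr // mulrC -ltr_pdivrMr ?exprn_gt0 //.
by have := h j; lra.
Qed.

(** The section concerns an MV-algebra on the whole type T, with ⊞ and ⊡ its sum
    and product. In the lattice-ordered group whose unit interval is T,
    (x ⊞ y) + (x ⊡ y) = x + y: a sum that is truncated leaves ⊡ as remainder. *)
Section Carry.
Context (R : realType) (T : eqType).
Context (op : T -> T -> T) (neg : T -> T) (zero one : T).
Context (mv : MV_algebra_on [set: T] op neg zero one).

Local Notation "x ⊞ y" := (op x y) (at level 50, left associativity).
Local Notation "x ⊡ y" :=
  (neg (neg x ⊞ neg y)) (at level 40, left associativity).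
Implicit Types (x y z u v : T) (p q r : nat * T).

Let opA x y z : x ⊞ (y ⊞ z) = x ⊞ y ⊞ z. Proof. exact: (mv_opA mv). Qed.
Let opC x y : x ⊞ y = y ⊞ x. Proof. exact: (mv_opC mv). Qed.
Let op0 x : x ⊞ zero = x. Proof. exact: (mv_op0 mv). Qed.
Let op1 x : x ⊞ one = one. Proof. exact: (mv_op1 mv). Qed.
Let negK x : neg (neg x) = x. Proof. exact: (mv_negK mv). Qed.
Let neg0 : neg zero = one. Proof. exact: (mv_neg0 mv). Qed.
Let neg1 : neg one = zero. Proof. by rewrite -neg0 negK. Qed.
Let luk x y : neg (neg x ⊞ y) ⊞ y = neg (neg y ⊞ x) ⊞ x.
Proof. exact: (mv_luk mv). Qed.
Let op0l x : zero ⊞ x = x. Proof. by rewrite opC op0. Qed.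
Let op1l x : one ⊞ x = one. Proof. by rewrite opC op1. Qed.
Let opNx x : neg x ⊞ x = one.
Proof. by have := luk x one; rewrite !op1 neg1 op0l => <-. Qed.
Let dotC x y : x ⊡ y = y ⊡ x. Proof. by rewrite opC. Qed.
Let dotA x y z : x ⊡ (y ⊡ z) = x ⊡ y ⊡ z. Proof. by rewrite !negK opA. Qed.

(** If x + y >= 1 then x = (x + y - 1) + (1 - y). *)
Let sum_split x y : x ⊞ y = one -> (x ⊡ y) ⊞ neg y = x.
Proof. by move=> xy; rewrite luk negK opC [y ⊞ x]opC xy neg1 op0. Qed.

(** The three exchange laws are the associativity of x + y + z, split by whether
    x + y and y + z reach 1; the two digits of the name are these carries. *)
Let exchange11 x y z : x ⊞ y = one -> y ⊞ z = one ->
  (x ⊡ y) ⊞ z = x ⊞ (y ⊡ z).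
Proof.
(* Both sides are (x ⊡ y) + (z ⊡ y) + (1 - y). *)
move=> xy; rewrite opC => zy; rewrite -{1}(sum_split zy) -{2}(sum_split xy).
by rewrite (dotC z y) -!opA; congr (_ ⊞ _); exact: opC.
Qed.

Let exchange00 x y z : x ⊡ y = zero -> y ⊡ z = zero ->
  (x ⊞ y) ⊡ z = x ⊡ (y ⊞ z).
Proof.
move=> /(congr1 neg); rewrite negK neg0 => xy.
move=> /(congr1 neg); rewrite negK neg0 => yz.
by congr neg; have := exchange11 xy yz; rewrite !negK.
Qed.

Let exchange10 x y z : x ⊞ y = one -> y ⊡ z = zero ->
  (x ⊡ y) ⊞ z = x ⊡ (y ⊞ z).
Proof.
(* Here 1 - y = v + z, so x = p + (1 - y) = (p + z) + v, and p + z is recovered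
   as x - v because p + z <= y + z = 1 - v. *)
move=> xy yz; set p := x ⊡ y; set v := neg (y ⊞ z).
have ev : v ⊞ z = neg y.
  have h : neg y ⊞ neg z = one by rewrite -neg0 -yz negK.
  have := luk (neg y) z; rewrite negK -/v => ->.
  by rewrite [neg z ⊞ _]opC h neg1 op0l.
have le : neg (p ⊞ z) ⊞ (y ⊞ z) = one.
  rewrite [y ⊞ z]opC opA.
  have := luk (neg p) z; rewrite negK => ->.
  by rewrite -opA /p negK -[neg x ⊞ neg y ⊞ y]opA opNx !op1.
have -> : x ⊡ (y ⊞ z) = neg (neg (p ⊞ z ⊞ v) ⊞ v).
  by rewrite -opA [z ⊞ v]opC ev sum_split // /v negK.
have := luk (neg (p ⊞ z)) v; rewrite negK => ->.
by rewrite /v negK [y ⊞ z ⊞ _]opC le neg1 op0l negK.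
Qed.

(** The pair (n, x) stands for n + x. Pairs are not normalized: (n, one) and
    (n.+1, zero) have the same value. The operation is nevertheless associative
    on all pairs, but (0, zero) is not neutral. *)
Definition carry_add p q : nat * T :=
  if p.2 ⊞ q.2 == one then ((p.1 + q.1).+1, p.2 ⊡ q.2)
  else ((p.1 + q.1)%N, p.2 ⊞ q.2).

Local Notation "p ⊹ q" := (carry_add p q) (at level 50, left associativity).

(** Without a carry, nothing may be lost: this is what total order is needed
    for. *)
Context (chain : forall x y, x ⊞ y <> one -> x ⊡ y = zero).

Lemma carry_addC p q : p ⊹ q = q ⊹ p.
Proof. by rewrite /carry_add opC [neg _ ⊞ _]opC addnC. Qed.

Let op_eq0 u v : u ⊞ v = zero -> v = zero.
Proof.
by move=> uv; have := op1 u; rewrite -(opNx v) [neg v ⊞ v]opC opA uv op0l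
  => /(congr1 neg); rewrite negK opC opNx neg1.
Qed.

Let dot_eq1 x y : x ⊡ y = one -> y = one.
Proof.
by move=> /(congr1 neg); rewrite negK neg1 => /op_eq0 /(congr1 neg);
  rewrite negK neg0.
Qed.

(** Reduced to the exchange laws by cases on the carries of x + y and y + z; in
    the two mixed cases the total carry is exactly 1, since a product equals one
    only if both factors do. *)
Lemma carry_addA p q r : p ⊹ (q ⊹ r) = p ⊹ q ⊹ r.
Proof.
case: p q r => [m x] [n y] [k z]; rewrite /carry_add /=.
case: (x ⊞ y =P one) => xy; case: (y ⊞ z =P one) => yz /=.
- by rewrite -exchange11 // dotA; case: ifP; rewrite !addnS !addSn addnA.
- rewrite (exchange10 xy (chain yz)) [x ⊞ (y ⊞ z)]opA xy op1l eqxx addnA addSn.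
  by case: eqP => // /dot_eq1.
- have zy : z ⊞ y = one by rewrite opC.
  have yx : y ⊡ x = zero by rewrite dotC chain.
  have -> : x ⊞ (y ⊡ z) = (x ⊞ y) ⊡ z.
    by rewrite opC (dotC y z) (exchange10 zy yx) dotC [y ⊞ x]opC.
  rewrite -opA yz op1 eqxx addnS addnA.
  by case: eqP => // h; case: xy; move: h; rewrite dotC => /dot_eq1.
- by rewrite opA addnA (exchange00 (chain xy) (chain yz)).
Qed.

Lemma carry_addACA p q r t : (p ⊹ q) ⊹ (r ⊹ t) = (p ⊹ r) ⊹ (q ⊹ t).
Proof. by rewrite -!carry_addA (carry_addA q) (carry_addC q) -!carry_addA. Qed.

Definition carry_double p := p ⊹ p.

Lemma carry_doubleD j p q :
  iter j carry_double (p ⊹ q) = iter j carry_double p ⊹ iter j carry_double q.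
Proof. by elim: j => //= j ->; rewrite /carry_double carry_addACA. Qed.

Lemma carry_add_fst p q : (p.1 + q.1 <= (p ⊹ q).1 <= (p.1 + q.1).+1)%N.
Proof. by rewrite /carry_add; case: ifP; rewrite /= leqnn leqnSn. Qed.

Lemma carry_double_fst j p :
  (2 ^ j * p.1 <= (iter j carry_double p).1 /\
   (iter j carry_double p).1 < 2 ^ j * p.1.+1)%N.
Proof.
elim: j => [|j]; first by rewrite expn0 /=; lia.
rewrite expnS iterS; set q := iter j carry_double p.
by have := carry_add_fst q q; rewrite -/(carry_double q) => /andP[]; lia.
Qed.

Local Open Scope ring_scope.

(** A pair exceeds its first component by at most 1, so this is a lower
    approximation of the value of p, with error at most 2^-j. *)
Definition dyadic j p : R := (iter j carry_double p).1%:R / 2 ^+ j.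

Lemma dyadic_le i j p : dyadic i p <= dyadic j p + 1 / 2 ^+ j.
Proof.
rewrite -mulrDl /dyadic; have [ij|/ltnW ji] := leqP i j.
- have [h _] := carry_double_fst (j - i) (iter i carry_double p).
  rewrite -iterD subnK // in h.
  rewrite ler_pdivrMr ?exprn_gt0 // mulrAC ler_pdivlMr ?exprn_gt0 //.
  rewrite -{1}(subnK ij) exprD mulrA ler_pM2r ?exprn_gt0 //.
  rewrite -natrX -natrM (@le_trans _ _ ((iter j carry_double p).1%:R)) //.
    by rewrite ler_nat mulnC.
  by rewrite lerDl.
- have [_ h] := carry_double_fst (i - j) (iter j carry_double p).
  rewrite -iterD subnK // in h.
  rewrite ler_pdivrMr ?exprn_gt0 // mulrAC ler_pdivlMr ?exprn_gt0 //.
  rewrite -{2}(subnK ji) exprD mulrA ler_pM2r ?exprn_gt0 //.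
  rewrite -natrX natr1 -natrM ler_nat mulnC; exact: ltnW.
Qed.

Definition dyadic_limit p : R := sup [set dyadic j p | j in [set: nat]].

Lemma dyadic_limit_bounds j p :
  dyadic j p <= dyadic_limit p <= dyadic j p + 1 / 2 ^+ j.
Proof.
apply/andP; split.
  apply: ub_le_sup; last by exists j.
  by exists (dyadic 0 p + 1 / 2 ^+ 0) => _ [i _ <-]; exact: dyadic_le.
apply: ge_sup; first by exists (dyadic 0 p); exists 0%N.
by move=> _ [i _ <-]; exact: dyadic_le.
Qed.

(** Doubling is additive and first components are additive up to one carry, so
    the two sides differ by O(2^-j) for every j. *)
Lemma dyadic_limit_add p q :
  dyadic_limit (p ⊹ q) = dyadic_limit p + dyadic_limit q.
Proof.
have h j : dyadic j p + dyadic j q <= dyadic j (p ⊹ q) <=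
    dyadic j p + dyadic j q + 1 / 2 ^+ j.
  rewrite /dyadic carry_doubleD -!mulrDl !ler_pM2r ?invr_gt0 ?exprn_gt0 //.
  by rewrite -!natrD natr1 !ler_nat carry_add_fst.
apply/le_anti/andP; split; apply: (@le_dyadic _ 2) => j;
  move: (h j) (dyadic_limit_bounds j p) (dyadic_limit_bounds j q)
    (dyadic_limit_bounds j (p ⊹ q));
  move=> /andP[? ?] /andP[? ?] /andP[? ?] /andP[? ?]; lra.
Qed.

Context (nontrivial : zero <> one).

Definition chain_value x : R := dyadic_limit (0%N, x).

Lemma chain_value_ge0 x : 0 <= chain_value x.
Proof.
by have /andP[h _] := dyadic_limit_bounds 0 (0%N, x); rewrite /dyadic mul0r in h.
Qed.

Lemma chain_value_le1 x : chain_value x <= 1.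
Proof.
have /andP[_ h] := dyadic_limit_bounds 0 (0%N, x).
by rewrite /dyadic mul0r add0r divr1 in h.
Qed.

Let dyadic_limit_nat n : dyadic_limit (n, zero) = n%:R.
Proof.
have e j : iter j carry_double (n, zero) = (2 ^ j * n, zero)%N.
  elim: j => [|j ih]; first by rewrite mul1n.
  rewrite iterS ih /carry_double /carry_add /= op0; case: eqP => // _.
  by rewrite expnS -mulnA mul2n addnn.
have d j : dyadic j (n, zero) = n%:R.
  by rewrite /dyadic e natrM natrX mulrAC mulfV ?mul1r // expf_neq0.
have b j : n%:R <= dyadic_limit (n, zero) <= n%:R + 1 / 2 ^+ j.
  by have := dyadic_limit_bounds j (n, zero); rewrite d.
apply/le_anti; have /andP[-> _] := b 0%N; rewrite andbT.
by apply: (@le_dyadic _ 1) => j; have /andP[] := b j.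
Qed.

Lemma chain_value0 : chain_value zero = 0.
Proof. exact: dyadic_limit_nat. Qed.

Lemma chain_value1 : chain_value one = 1.
Proof.
have := dyadic_limit_add (0%N, one) (0%N, zero).
rewrite /carry_add /= op0 eqxx neg1 neg0 op1 neg1.
by rewrite !dyadic_limit_nat addr0 /chain_value => <-.
Qed.

Lemma chain_value_op x y :
  chain_value (x ⊞ y) = Num.min (chain_value x + chain_value y) 1.
Proof.
have := dyadic_limit_add (0%N, x) (0%N, y).
rewrite /carry_add /=; case: eqP => xy e.
  rewrite xy chain_value1 min_r // /chain_value -e.
  have : dyadic_limit (1%N, x ⊡ y) >= 1.
    have /andP[h _] := dyadic_limit_bounds 0 (1%N, x ⊡ y).
    by rewrite /dyadic divr1 in h.
  by [].
rewrite /chain_value min_l -e; [by []|exact: chain_value_le1].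
Qed.

Lemma chain_value_neg x : chain_value (neg x) = 1 - chain_value x.
Proof.
have := dyadic_limit_add (0%N, neg x) (0%N, x).
rewrite /carry_add /= opNx eqxx negK [x ⊞ _]opC opNx neg1 dyadic_limit_nat.
rewrite -!/(chain_value _).
by rewrite addn0 => e; apply/eqP; rewrite eq_sym subr_eq -e.
Qed.

(** Simplicity gives injectivity: it excludes infinitesimals, whose value would
    be 0. *)
Lemma simple_chain_embedding :
  (forall x, x <> zero -> exists n, iter n (op x) zero = one) ->
  exists f : T -> R, [/\ forall x, 0 <= f x <= 1,
    forall x y, f (x ⊞ y) = Num.min (f x + f y) 1,
    forall x, f (neg x) = 1 - f x, f one = 1 &
    forall x, f x = 0 -> x = zero].
Proof.
move=> simple; exists chain_value; split.
- by move=> x; rewrite chain_value_ge0 chain_value_le1.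
- exact: chain_value_op.
- exact: chain_value_neg.
- exact: chain_value1.
move=> x sx; apply: contrapT => /simple[n e].
have : chain_value (iter n (op x) zero) = 0.
  elim: {e} n => [|n ih]; first exact: chain_value0.
  by rewrite iterS chain_value_op ih sx addr0 min_l.
by rewrite e chain_value1 => /eqP; rewrite oner_eq0.
Qed.

End Carry.

(** * Quotient by a maximal ideal *)

Section MaximalIdeal.
Context {d : Order.disp_t} {M : emvType d} (I : set M) (maxI : maximal_ideal I).
Implicit Types (a b x y : M).

Let Ile x y : x <= y -> I y -> I x.
Proof. by have [[_ h _] _ _] := maxI; exact: h. Qed.

Let Iop x y : I x -> I y -> I (x ⊕ y).
Proof. by have [[_ _ h] _ _] := maxI; exact: h. Qed.

Let I0 : I \bot.
Proof. by have [[[x Ix] _ _] _ _] := maxI; exact: Ile (le0x x) Ix. Qed.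

(** The elements y such that y ⊖ n x is in I for some n form the ideal generated
    by I and x, which is everything by maximality. *)
Lemma maximal_ideal_multiple x : ~ I x ->
  forall y, exists n, I (y ⊖ iter n (oplus x) \bot).
Proof.
move=> Ix y; apply: contrapT => Iy; have [_ _ maxi] := maxI.
pose J := [set z | exists n, I (z ⊖ iter n (oplus x) \bot)].
apply: (maxi J).
- split.
  + by exists \bot, 0%N; rewrite residual_eq0.
  + by move=> u z uz [n Iz]; exists n; apply: Ile Iz; exact: residual_mono.
  + move=> u z [n Iu] [m Iz]; exists (n + m)%N; rewrite iter_oplusD.
    by apply: Ile (oplus_residual_le _ _ _ _) _; exact: Iop.
- by move=> JT; apply: Iy; have : J y by rewrite JT.
- split.
    by move=> z Iz; exists 0%N; apply: Ile Iz; exact: residual_le_self.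
  by move=> /(_ x) h; apply/Ix/h; exists 1%N; rewrite /= oplus0 residual_eq0.
Qed.

(** If x is not in I, then y ⊖ n x is in I for some n. But y is disjoint from x,
    hence from n x, so that y <= y ⊖ n x. *)
Lemma maximal_ideal_prime x y : x `&` y = \bot -> I x \/ I y.
Proof.
move=> xy; have [?|Ix] := pselect (I x); [by left|right].
have [n Iyn] := maximal_ideal_multiple Ix y.
have yn : y `&` iter n (oplus x) \bot = \bot.
  elim: n {Iyn} => [|n ih]; first by rewrite meetx0.
  apply/eqP; rewrite -lex0 (le_trans (meet_oplus_le _ _ _)) //.
  by rewrite ih meetC xy oplus0.
apply: Ile Iyn; have := le_meet_residual y (iter n (oplus x) \bot).
by rewrite yn oplusC oplus0.
Qed.

Lemma maximal_ideal_idem : exists2 a, idem M a & ~ I a.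
Proof.
apply: contrapT => h; have [_ Ip _] := maxI; apply: Ip; rewrite -subTset => x _.
have [a ia xa] := idem_cofinal x; apply: (Ile xa).
by apply: contrapT => Ia; apply: h; exists a.
Qed.

Lemma maximal_ideal_residual_idem a x : idem M a -> ~ I a -> I (x ⊖ a).
Proof.
by move=> ia Ia; have [] := maximal_ideal_prime (residual_idem_disjoint x ia).
Qed.

Definition icong : rel M := fun x y => `[< I (x ⊖ y) /\ I (y ⊖ x) >].

Lemma icong_refl : reflexive icong.
Proof. by move=> x; apply/asboolP; rewrite residual_eq0. Qed.

Lemma icong_sym : symmetric icong.
Proof. by move=> x y; apply/asboolP/asboolP => -[]. Qed.

Lemma icong_trans : transitive icong.
Proof.
move=> y x z /asboolP[xy yx] /asboolP[yz zy]; apply/asboolP.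
by split; apply: Ile (residual_triangle _ y _) _; exact: Iop.
Qed.

Canonical icong_equiv := EquivRel icong icong_refl icong_sym icong_trans.

Local Open Scope quotient_scope.
(** The quotient of the whole of M, rather than of an interval. It does not
    depend on a choice of idempotent, which only names its top element. *)
Definition iquot := {eq_quot icong_equiv}.
HB.instance Definition _ := Choice.on iquot.

Definition iproj (x : M) : iquot := \pi_{eq_quot icong_equiv} x.
Definition irepr (X : iquot) : M := repr (X : {eq_quot icong_equiv}).

Lemma iprojP x y : iproj x = iproj y <-> I (x ⊖ y) /\ I (y ⊖ x).
Proof. by split => [/eqmodP/asboolP //|h]; apply/eqmodP/asboolP. Qed.

Lemma ireprK X : iproj (irepr X) = X.
Proof. exact: reprK. Qed.

Context (a : M) (ia : idem M a) (Ia : ~ I a).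

Definition iquot_op (X Y : iquot) := iproj (irepr X ⊕ irepr Y).
Definition iquot_neg (X : iquot) := iproj (a ⊖ irepr X).

Lemma iquot_op_proj x y : iquot_op (iproj x) (iproj y) = iproj (x ⊕ y).
Proof.
have [xx xx'] := (iprojP _ _).1 (ireprK (iproj x)).
have [yy yy'] := (iprojP _ _).1 (ireprK (iproj y)).
by apply/iprojP; split; apply: Ile (oplus_residual_le _ _ _ _) _; exact: Iop.
Qed.

Lemma iquot_neg_proj b x : idem M b -> ~ I b ->
  iquot_neg (iproj x) = iproj (b ⊖ x).
Proof.
move=> ib Ib; have [xx xx'] := (iprojP _ _).1 (ireprK (iproj x)).
apply/iprojP; split; apply: Ile (residual_residual_le _ _ _ _) _;
  by apply: Iop => //; exact: maximal_ideal_residual_idem.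
Qed.

(** Modulo I, x equals x ∧ a because x ⊖ a is in I. Hence the quotient inherits
    the MV-algebra axioms from [0, a]. *)
Lemma iproj_below X : exists2 x, x <= a & X = iproj x.
Proof.
exists (irepr X `&` a); first exact: leIr.
rewrite -{1}[X]ireprK; apply/iprojP; split.
  apply: (@Ile _ (irepr X ⊖ a)); last exact: maximal_ideal_residual_idem.
  by rewrite residual_le le_meet_residual.
by rewrite residual_eq0 ?leIl.
Qed.

Lemma iquot_MV :
  MV_algebra_on [set: iquot] iquot_op iquot_neg (iproj \bot) (iproj a).
Proof.
have mv := interval_MV _ ia.
have N x : x <= a -> iquot_neg (iproj x) = iproj (lam oplus a x).
  by move=> xa; rewrite (iquot_neg_proj _ ia Ia) -lambda_residual.
have cN x : x <= a -> lam oplus a x <= a by exact: lambda_le_idem.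
have cD x y : x <= a -> y <= a -> x ⊕ y <= a by exact: oplus_idem_le.
split => //.
- move=> X Y Z _ _ _; have [x xa ->] := iproj_below X.
  have [y ya ->] := iproj_below Y; have [z za ->] := iproj_below Z.
  by rewrite !iquot_op_proj oplusA.
- by move=> X Y _ _; rewrite /iquot_op oplusC.
- by move=> X _; have [x xa ->] := iproj_below X; rewrite iquot_op_proj oplus0.
- move=> X _; have [x xa ->] := iproj_below X.
  by rewrite !N ?cN // (mv_negK mv).
- by rewrite N ?le0x // (mv_neg0 mv).
- move=> X _; have [x xa ->] := iproj_below X.
  by rewrite iquot_op_proj (mv_op1 mv).
- move=> X Y _ _; have [x xa ->] := iproj_below X.
  have [y ya ->] := iproj_below Y.
  by rewrite !(N, iquot_op_proj) ?(cN, cD) // (mv_luk mv).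
Qed.

Lemma iproj_eq0 x : iproj x = iproj \bot <-> I x.
Proof.
split => [/iprojP[h _]|Ix].
  by apply: Ile h; rewrite -[leRHS]oplus0 oplusC le_residual.
apply/iprojP; split; last by rewrite residual_eq0 ?le0x.
by apply: Ile Ix; exact: residual_le_self.
Qed.

(** For x, y <= a, the product of x and y is x ⊖ (a ⊖ y) and the complement of
    their sum is (a ⊖ y) ⊖ x. These are disjoint, so one of them is in I. *)
Lemma iquot_chain X Y : iquot_op X Y <> iproj a ->
  iquot_neg (iquot_op (iquot_neg X) (iquot_neg Y)) = iproj \bot.
Proof.
have [x xa ->] := iproj_below X; have [y ya ->] := iproj_below Y.
rewrite !(iquot_neg_proj _ ia Ia, iquot_op_proj) => xy.
have lam_in b : a ⊖ b <= a by exact: residual_le_self.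
have e1 : x ⊖ (a ⊖ y) = a ⊖ ((a ⊖ x) ⊕ (a ⊖ y)).
  by rewrite (residualE ia) // !lambda_residual // oplus_idem_le.
have e2 : (a ⊖ y) ⊖ x = a ⊖ (x ⊕ y).
  rewrite (residualE ia) // !lambda_residual ?residualK ?oplus_idem_le //.
  by rewrite oplusC.
have [|] := maximal_ideal_prime (residual_disjoint x (a ⊖ y)).
  by rewrite e1 => /iproj_eq0.
rewrite e2 => h; case: xy; apply/iprojP; split => //.
by rewrite residual_eq0 ?oplus_idem_le.
Qed.

Lemma iquot_nontrivial : iproj \bot <> iproj a.
Proof. by move=> /esym/iproj_eq0. Qed.

Lemma iquot_simple X : X <> iproj \bot ->
  exists n, iter n (iquot_op X) (iproj \bot) = iproj a.
Proof.
have [x _ ->] := iproj_below X => /iproj_eq0 Ix.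
have [n In] := maximal_ideal_multiple Ix a; exists n.
have -> : iter n (iquot_op (iproj x)) (iproj \bot) =
    iproj (iter n (oplus x) \bot).
  by elim: n {In} => //= n ->; exact: iquot_op_proj.
by apply/iprojP; split => //; exact: maximal_ideal_residual_idem.
Qed.

End MaximalIdeal.

Section Existence.
Context (R : realType) {d : Order.disp_t} {M : emvType d}.

(** The value of the class of x in M / I is the state. Joins and meets reduce to
    the case x ⊖ y in I or y ⊖ x in I: elements that differ by an element of I
    have the same value. An idempotent b has value 0 or 1 according to whether it
    is in I, and in the second case b is as good a top as a, which gives the
    compatibility with lambda_b. *)
Lemma maximal_ideal_state (I : set M) : maximal_ideal I ->
  exists s : M -> unit_itv R, state_morphism s /\ I = Ker s.
Proof.
move=> maxI; have [a ia Ia] := maximal_ideal_idem maxI.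
have [v [v01 v_op v_neg v1 v_eq0]] := simple_chain_embedding R
  (iquot_MV maxI ia Ia) (iquot_chain ia Ia) (iquot_nontrivial (maxI:=maxI) Ia)
  (iquot_simple ia Ia).
pose f x : R := v (iproj maxI x).
have f_ge0 x : (0 <= f x)%R by have /andP[] := v01 (iproj maxI x).
have f_le1 x : (f x <= 1)%R by have /andP[] := v01 (iproj maxI x).
pose s x : unit_itv R := Itv01 (f_ge0 x) (f_le1 x).
have sE x : unit_val (s x) = f x by [].
have [[I0 Id ID] _ _] := maxI.
have f_neg b x : idem M b -> ~ I b -> f (b ⊖ x) = (1 - f x)%R.
  by move=> ib Ib; rewrite -v_neg (iquot_neg_proj maxI ia Ia _ ib Ib).
have f_idem b : idem M b -> ~ I b -> f b = 1%R.
  move=> ib Ib; rewrite -v1; congr v.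
  by apply/iprojP; split; exact: maximal_ideal_residual_idem.
have fI x : I x -> f x = 0%R.
  move=> /iproj_eq0 e; rewrite /f e -(residual_eq0 (lexx a)).
  by rewrite -/(f _) f_neg // f_idem // subrr.
have f_op x y : f (x ⊕ y) = Num.min (f x + f y)%R 1%R.
  by rewrite -v_op iquot_op_proj.
have f_mono x y : x <= y -> (f x <= f y)%R.
  move=> xy; rewrite -(oplus_residual xy) f_op le_min f_le1 andbT.
  by rewrite lerDl f_ge0.
have f_dom x y : I (x ⊖ y) -> f (x `|` y) = f y /\ f (x `&` y) = f x.
  move=> h; have absorb z : f (z ⊕ (x ⊖ y)) = f z.
    by rewrite f_op (fI _ h) addr0 min_l.
  split; apply/le_anti/andP; split.
  - by rewrite -[leRHS]absorb f_mono // leUx le_residual le_oplus_addr.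
  - by rewrite f_mono // leUr.
  - by rewrite f_mono // leIl.
  - by rewrite -[leRHS]absorb f_mono // le_meet_residual.
have s_dom x y : I (x ⊖ y) ->
    [/\ s x <= s y, s (x `|` y) = s y & s (x `&` y) = s x].
  move=> /f_dom[e1 e2]; split; [|exact: unit_val_inj|exact: unit_val_inj].
  by rewrite unit_leE !sE -e1 f_mono ?leUl.
exists s; split.
  split; last by exists a; rewrite sE f_idem.
  split.
  - move=> x y; have [|] := maximal_ideal_prime maxI (residual_disjoint x y).
      by move=> /s_dom[xy -> _]; rewrite join_r.
    by move=> /s_dom[xy e _]; rewrite joinC e join_l.
  - move=> x y; have [|] := maximal_ideal_prime maxI (residual_disjoint x y).
      by move=> /s_dom[xy _ ->]; rewrite meet_l.
    by move=> /s_dom[xy _ e]; rewrite meetC e meet_r.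
  - by move=> x y; apply: unit_val_inj; rewrite unit_oplusE !sE.
  - apply: unit_val_inj; rewrite unit_botE sE fI //.
    by case: I0 => x Ix; exact: Id (le0x x) Ix.
  - move=> b x ib xb; apply: unit_val_inj; rewrite lambda_residual //.
    have sb : unit_oplus (s b) (s b) = s b.
      by apply: unit_val_inj; rewrite unit_oplusE !sE -f_op (ib : b ⊕ b = b).
    rewrite unit_lamE //; last by rewrite unit_leE !sE f_mono.
    rewrite !sE; have [Ib|Ib] := pselect (I b).
      rewrite !fI ?subrr //; first exact: Id xb Ib.
      exact: Id (residual_le_self _ _) Ib.
    by rewrite f_neg // (f_idem b).
apply/seteqP; split => x; first exact: fI.
by move=> sx0; apply/iproj_eq0/v_eq0; exact: sx0.
Qed.

End Existence.

(** * Kernels of state-morphisms *)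

Section State.
Context {R : realType} {d : Order.disp_t} {M : emvType d}.
Context (s : M -> unit_itv R) (ss : state_morphism s).
Implicit Types (a b x y : M).
Local Open Scope ring_scope.
Local Notation v x := (unit_val (s x)).

Lemma state_oplus x y : v (x ⊕ y) = Num.min (v x + v y) 1.
Proof. by rewrite (hom_oplus (state_hom ss)). Qed.

Lemma state0 : v \bot = 0.
Proof. by rewrite (hom_zero (state_hom ss)). Qed.

Lemma state_mono x y : (x <= y)%O -> v x <= v y.
Proof.
move=> xy; rewrite -unit_leE -(join_idPl xy) (hom_join (state_hom ss)).
exact: leUr.
Qed.

Lemma state_lambda b x : idem M b -> (x <= b)%O -> v (lambda b x) = v b - v x.
Proof.
move=> ib xb; rewrite (hom_lambda (state_hom ss)) // unit_lamE //.
- by rewrite -[RHS](congr1 s ib) (hom_oplus (state_hom ss)).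
- by rewrite unit_leE state_mono.
Qed.

(** On the interval [0, a] below such an a, the map s is a homomorphism of
    MV-algebras that preserves the top, so values can be computed there. *)
Lemma state_top x y : exists a, [/\ idem M a, (x <= a)%O, (y <= a)%O & v a = 1].
Proof.
have [t t1] := state_one ss; have [a ia [xa ya ta]] := idem_above3 x y t.
exists a; split => //; apply/le_anti; rewrite unit_val_le1 /=.
by rewrite -t1 state_mono.
Qed.

Lemma state_residual x y : v (x ⊖ y) = Num.max (v x - v y) 0.
Proof.
have [a [ia xa ya a1]] := state_top x y.
have lx := lambda_le_idem ia xa.
rewrite (residualE ia) // state_lambda ?oplus_idem_le // state_oplus.
rewrite state_lambda // a1.
by rewrite /Order.min /Order.max; repeat case: ifP; lra.
Qed.

Lemma state_odot x y : v (odot x y) = Num.max (v x + v y - 1) 0.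
Proof.
have [a [ia xa ya a1]] := state_top x y.
rewrite (odot_residual ia) // !state_residual a1.
have := unit_val_le1 (s y).
by rewrite /Order.max; repeat case: ifP; lra.
Qed.

Lemma state_iter x n : v (iter n (oplus x) \bot) = Num.min (v x *+ n) 1.
Proof.
elim: n => [|n ih]; first by rewrite state0 mulr0n min_l.
rewrite iterS state_oplus ih mulrS; have := unit_val_ge0 (s x).
by rewrite /Order.min; repeat case: ifP; lra.
Qed.

Lemma state_archi x : v x <> 0 -> exists n, v (iter n (oplus x) \bot) = 1.
Proof.
move=> /eqP x0; have xp : 0 < v x by rewrite lt_neqAle eq_sym x0 unit_val_ge0.
exists (Num.bound (1 / v x)); rewrite state_iter min_r // -mulr_natl.
rewrite -ler_pdivrMr // ltW // archi_boundP // divr_ge0 // ltW //.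
Qed.

Lemma Ker_maximal : maximal_ideal (Ker s).
Proof.
split.
- split; first by exists \bot; exact: state0.
  + move=> x y /state_mono xy y0; have := unit_val_ge0 (s x).
    by move: y0; rewrite /Ker /=; lra.
  + by move=> x y x0 y0; rewrite /Ker /= state_oplus x0 y0 addr0 min_l.
- move=> e; have [x x1] := state_one ss; have : Ker s x by rewrite e.
  by rewrite /Ker /= x1 => /eqP; rewrite oner_eq0.
- move=> J [J0 Jd JD] Jp [KJ /existsNP[x /not_implyP[Jx x0]]].
  have [n nx] := state_archi x0; apply: Jp; rewrite -subTset => y _.
  have Jn : J (iter n (oplus x) \bot).
    elim: (n) => [|m ih]; last exact: JD.
    by apply: KJ; exact: state0.
  apply: Jd (le_residual y (iter n (oplus x) \bot)) _; apply: JD => //.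
  by apply: KJ; rewrite /Ker /= state_residual nx max_r // subr_le0 unit_val_le1.
Qed.

Lemma Ker1_maximal : maximal_filter (Ker1 s).
Proof.
split.
- split; first by have [x] := state_one ss; exists x.
  + move=> x y /state_mono xy x1; have := unit_val_le1 (s y).
    by move: x1; rewrite /Ker1 /=; lra.
  + by move=> x y x1 y1; rewrite /Ker1 /= state_odot x1 y1 addrK max_l.
- move=> e; have : Ker1 s \bot by rewrite e.
  by rewrite /Ker1 /= state0 => /eqP; rewrite eq_sym oner_eq0.
- move=> G [G0 Gu Go] Gp [KG /existsNP[x /not_implyP[Gx x1]]].
  have [a [ia xa _ a1]] := state_top x x.
  have y0 : v (a ⊖ x) <> 0.
    have := unit_val_le1 (s x); rewrite state_residual a1.
    by move: x1; rewrite /Ker1 /= /Order.max; case: ifP; lra.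
  (* With y = a ⊖ x, the complement a ⊖ n y is the n-th power of x. *)
  have [n] := state_archi y0; set w := iter _ _ _ => w1.
  have ita m : (iter m (oplus (a ⊖ x)) \bot <= a)%O.
    elim: m => [|m ih]; first exact: le0x.
    by rewrite iterS oplus_idem_le // residual_le_self.
  have Gn m : G (a ⊖ iter m (oplus (a ⊖ x)) \bot).
    elim: m => [|m ih].
      apply: KG; rewrite /Ker1 /= state_residual state0 a1 subr0 max_l //.
    set t := iter m _ _ in ih *.
    have -> : a ⊖ iter m.+1 (oplus (a ⊖ x)) \bot = odot x (a ⊖ t).
      rewrite (odot_residual ia) ?residual_le_self // residualK ?ita //.
      by rewrite (residualE ia xa (ita m)) (lambda_residual ia xa)
        (lambda_residual ia (ita m.+1)).
    exact: Go.
  apply: Gp; rewrite -subTset => y _.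
  apply: Gu (le0x y) _.
  have -> : \bot = odot w (a ⊖ w).
    rewrite (odot_residual ia) ?residual_le_self ?ita // residualK ?ita //.
    by rewrite residual_eq0.
  by apply: Go; [exact: (KG w w1)|exact: Gn].
Qed.

End State.

Section Uniqueness.
Context {R : realType} {d : Order.disp_t} {M : emvType d}.
Context (s s' : M -> unit_itv R).
Context (ss : state_morphism s) (ss' : state_morphism s').
Local Open Scope ring_scope.

(** By induction on j, the values of s and s' differ by at most 2^-j: either both
    s (x ⊕ x) and s' (x ⊕ x) are 1, and then x ⊙ x has values 2 s(x) - 1 and
    2 s'(x) - 1, or neither is, and then x ⊕ x has values 2 s(x) and 2 s'(x). *)
Lemma Ker1_inj : Ker1 s = Ker1 s' -> s = s'.
Proof.
move=> e.
have close j x :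
    `|unit_val (s x) - unit_val (s' x)| <= 1 / 2 ^+ j.
  elim: j x => [|j ih] x.
    have := unit_val_ge0 (s x); have := unit_val_le1 (s x).
    have := unit_val_ge0 (s' x); have := unit_val_le1 (s' x).
    by rewrite expr0 ler_norml; lra.
  have -> : 1 / 2 ^+ j.+1 = 1 / 2 ^+ j / 2 :> R by rewrite exprSr invfM mulrA.
  have [h|h] := pselect (Ker1 s (x ⊕ x)).
    have h' : Ker1 s' (x ⊕ x) by rewrite -e.
    have := ih (odot x x); rewrite !state_odot //.
    move: h h'; rewrite /Ker1 /= !state_oplus // => /min_idPr h /min_idPr h'.
    rewrite !max_l ?subr_ge0 // !ler_norml => /andP[? ?].
    by apply/andP; split; lra.
  have h' : ~ Ker1 s' (x ⊕ x) by rewrite -e.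
  have := ih (x ⊕ x); move: h h'; rewrite /Ker1 /= !state_oplus //.
  move=> /min_idPr; rewrite -ltNge => /ltW h.
  move=> /min_idPr; rewrite -ltNge => /ltW h'.
  by rewrite !min_l // !ler_norml => /andP[? ?]; apply/andP; split; lra.
apply/funext => x; apply: unit_val_inj; apply/eqP; rewrite -subr_eq0 -normr_le0.
by apply: (@le_dyadic _ 1) => j; rewrite add0r.
Qed.

Lemma Ker_inj : Ker s = Ker s' -> s = s'.
Proof.
move=> e; apply: Ker1_inj; apply/seteqP.
have sub (r r' : M -> unit_itv R) : state_morphism r -> state_morphism r' ->
    Ker r = Ker r' -> Ker1 r `<=` Ker1 r'.
  move=> sr sr' ee x x1; have [a [ia xa _ a1]] := state_top sr' x x.
  have ra : unit_val (r a) = 1.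
    by apply/le_anti; rewrite unit_val_le1 /= -[leLHS]x1 (state_mono sr).
  have : Ker r' (lambda a x).
    by rewrite -ee /Ker /= (state_lambda sr) // ra x1 subrr.
  rewrite /Ker /= (state_lambda sr') // a1 /Ker1 /= => /eqP.
  by rewrite subr_eq0 => /eqP.
by split; apply: sub.
Qed.

End Uniqueness.

(** * Ideal dual to a maximal filter *)

Section MaximalFilter.
Context {d : Order.disp_t} {M : emvType d} (F : set M) (maxF : maximal_filter F).
Implicit Types (a b f x y t : M).

Let Fle x y : x <= y -> F x -> F y.
Proof. by have [[_ h _] _ _] := maxF; exact: h. Qed.

Let Fod x y : F x -> F y -> F (odot x y).
Proof. by have [[_ _ h] _ _] := maxF; exact: h. Qed.

(** The elements y with y ⊙ f = 0 for some f in F. The element t is arbitrary: if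
    b is an idempotent above t and f, then t ⊖ f <= b ⊖ f = lambda_b f. *)
Definition dual_ideal : set M := [set y | exists f t, F f /\ y <= t ⊖ f].

Lemma dual_ideal_disjoint y : F y -> ~ dual_ideal y.
Proof.
move=> Fy [f [t [Ff yt]]]; have [_ Fp _] := maxF; apply: Fp.
rewrite -subTset => x _; apply: Fle (le0x x) _.
have [b ib [yb fb tb]] := idem_above3 y f t.
suff -> : \bot = odot y f by exact: Fod.
rewrite (odot_residual ib) // residual_eq0 // (le_trans yt) //.
exact: residual_mono.
Qed.

Lemma dual_ideal_lambda f b : F f -> dual_ideal (b ⊖ f).
Proof. by move=> Ff; exists f, b. Qed.

(** Let the ideal J contain the dual ideal and one more element y. The elements
    above some f ⊖ j, with f in F and j in J, form a filter that contains F and,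
    for an idempotent a of F above y, also a ⊖ y. The latter is not in F,
    or else y = a ⊖ (a ⊖ y) would be in the dual ideal. So the filter
    contains the bottom, that is f <= j for some f in F and j in J. Then f is in
    J, and x <= f ⊕ (x ⊖ f) puts every x in J. *)
Lemma dual_ideal_maximal : maximal_ideal dual_ideal.
Proof.
have [[[f0 Ff0] _ _] _ maxf] := maxF.
split.
- split.
  + by exists \bot, f0, \bot; split => //; exact: le0x.
  + by move=> x y xy [f [t [Ff yt]]]; exists f, t; split=> //; exact: le_trans yt.
  + move=> x y [f [t [Ff xt]]] [g [u [Fg yu]]].
    have [b ib [fb gb]] := idem_above2 f g.
    have [c ic [bc tc uc]] := idem_above3 b t u.
    have fc := le_trans fb bc; have gc := le_trans gb bc.
    exists (odot f g), c; split; first exact: Fod.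
    have lf := residual_le_self c f; have lg := residual_le_self c g.
    have -> : c ⊖ odot f g = (c ⊖ f) ⊕ (c ⊖ g).
      have h : (c ⊖ f) ⊕ (c ⊖ g) <= c by exact: oplus_idem_le.
      rewrite (odot_residual ic) // (residualE ic fc lg) (lambda_residual ic fc).
      by rewrite (lambda_residual ic h) residualK.
    apply: le_oplus.
      by apply: le_trans xt _; exact: residual_mono.
    by apply: le_trans yu _; exact: residual_mono.
- by move=> e; apply: (dual_ideal_disjoint Ff0); rewrite e.
- move=> J [_ Jd JD] Jp [IJ /existsNP[y /not_implyP[Jy Iy]]].
  pose G := [set x | exists f j, [/\ F f, J j & f ⊖ j <= x]].
  suff : G \bot.
    move=> [f [j [Ff Jj]]]; rewrite residual_le oplus0 => fj.
    apply: Jp; rewrite -subTset => x _.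
    apply: (Jd _ _ (le_residual x f)); apply: JD; first exact: Jd fj Jj.
    by apply: IJ; exact: dual_ideal_lambda.
  have : G = setT.
    apply: contrapT => Gp; apply: (maxf G) => //.
      split.
      * by exists f0, f0, y; split => //; exact: residual_le_self.
      * move=> u z uz [f [j [Ff Jj fj]]]; exists f, j.
        by split => //; exact: le_trans uz.
      * move=> u z [f [j [Ff Jj fj]]] [g [k [Fg Jk gk]]].
        exists (odot f g), (j ⊕ k); split; [exact: Fod|exact: JD|].
        by apply: le_trans (odot_residual_le fj gk) _.
    split.
      move=> f Ff; exists f, \bot; split => //; first exact: Jd (le0x y) Jy.
      exact: residual_le_self.
    have [a ia [ya fa]] := idem_above2 y f0.
    move=> /(_ (a ⊖ y)) h; apply: Iy.
    have Fa : F a by exact: Fle fa Ff0.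
    exists (a ⊖ y), a; rewrite residualK //; split=> //; apply: h.
    by exists a, y.
  by move=> ->.
Qed.

End MaximalFilter.

Theorem lemma3p5 (R : realType) (d : Order.disp_t) (M : emvType d) :
  (forall s : M -> unit_itv R, state_morphism s ->
     maximal_ideal (Ker s) /\ maximal_filter (Ker1 s)) /\
  (forall I : set M, maximal_ideal I ->
     exists! s : M -> unit_itv R, state_morphism s /\ I = Ker s) /\
  (forall F : set M, maximal_filter F ->
     exists! s1 : M -> unit_itv R, state_morphism s1 /\ F = Ker1 s1).
Proof.
split; [|split].
- by move=> s ss; split; [exact: Ker_maximal|exact: Ker1_maximal].
- move=> I maxI; have [s [ss Is]] := maximal_ideal_state R maxI.
  exists s; split => // s' [ss' Is'].
  by apply: Ker_inj => //; rewrite -Is.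
- move=> F maxF.
  have [s [ss Is]] := maximal_ideal_state R (dual_ideal_maximal maxF).
  have sub : F `<=` Ker1 s.
    move=> x Fx; have [a [ia xa _ a1]] := state_top ss x x.
    have : Ker s (a ⊖ x) by rewrite -Is; exact: dual_ideal_lambda.
    rewrite /Ker /= -lambda_residual // (state_lambda ss) // a1 => /eqP.
    by rewrite subr_eq0 => /eqP.
  have e : F = Ker1 s.
    apply: contrapT => ne; have [_ _] := maxF; apply; last first.
    - split; first exact: sub.
      by move=> sub'; apply: ne; apply/seteqP.
    - by have [] := Ker1_maximal ss.
    - by have [] := Ker1_maximal ss.
  exists s; split => // s' [ss' Fs'].
  by apply: Ker1_inj => //; rewrite -e.
Qed.
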